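(* Let $\Omega\subset\mathbb R^3$ be a bounded domain, let $N\ge3$ be an integer, and let $f\in H^1(\Omega,S^2)$. Then there exists $(u_1,\dots,u_N)\in H^1(\Omega,S^2)^N$ such that $$\sum_{i=1}^N u_i=f\qquad\text{a.e. in }\Omega.$$ Consequently, there exists a constant $C>0$, independent of $\lambda$, such that $$E_\lambda(f)\le C\qquad\text{for all }\lambda>0.$$
   Context: $S^2$ is the unit sphere of $\mathbb R^3$, and $H^1(\Omega,S^2)=\{u\in H^1(\Omega,\mathbb R^3):|u|=1\text{ a.e. in }\Omega\}$. For $\lambda>0$ and $U=(u_1,\dots,u_N)\in H^1(\Omega,S^2)^N$, $$F_\lambda(U)=\int_\Omega\Big(\frac12\sum_{i=1}^N|\nabla u_i|^2+\lambda\Big|\sum_{i=1}^N u_i-f\Big|^2\Big)dx,\qquad E_\lambda(f)=\inf_{U\in H^1(\Omega,S^2)^N}F_\lambda(U).$$ *)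

(* Defs.v *)
From HB Require Import structures.
From mathcomp Require Import all_boot all_order all_algebra.
From mathcomp Require Import all_classical all_reals all_analysis.

Set Implicit Arguments.
Unset Strict Implicit.
Unset Printing Implicit Defensive.

Import Order.TTheory GRing.Theory Num.Theory.
Import numFieldNormedType.Exports.

Local Open Scope classical_set_scope.
Local Open Scope ring_scope.

(* Points of R^3 are triples, so that Lebesgue measure is the library's product
   measure; the factors are [measurableTypeR R] (convertible to [R]) because
   that is the type which carries the Borel sigma-algebra. *)
Definition space3 (R : realType) : Type :=
  (measurableTypeR R * measurableTypeR R * measurableTypeR R)%type.

Section Sobolev.
Context {R : realType}.

Definition leb2 : set (measurableTypeR R * measurableTypeR R) -> \bar R :=
  (@lebesgue_measure R \x @lebesgue_measure R)%E.

HB.instance Definition _ := Measure.on leb2.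

Definition leb3 : set (space3 R) -> \bar R := (leb2 \x @lebesgue_measure R)%E.

HB.instance Definition _ := Measure.on leb3.

Definition basis3 (k : 'I_3) : R * R * R :=
  ((k == 0 :> nat)%:R, (k == 1 :> nat)%:R, (k == 2 :> nat)%:R).

Definition partial (k : 'I_3) (phi : R * R * R -> R) : R * R * R -> R :=
  fun x => 'D_(basis3 k) phi x.

Definition iter_partial (s : seq 'I_3) (phi : R * R * R -> R) :=
  foldr partial phi s.

Definition smooth (phi : R * R * R -> R) :=
  forall s : seq 'I_3,
    continuous (iter_partial s phi) /\
    forall k x, derivable (iter_partial s phi) x (basis3 k).

Definition test_function (Omega : set (R * R * R)) (phi : R * R * R -> R) :=
  [/\ smooth phi, compact (closure [set x | phi x != 0])
    & closure [set x | phi x != 0] `<=` Omega].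

Definition bounded_domain (Omega : set (R * R * R)) :=
  [/\ open Omega, connected Omega, Omega !=set0 & bounded_set Omega].

(* The Euclidean (Frobenius) norm; the library's [`|A|] on matrices is the sup
   norm. *)
Definition enorm m n (A : 'M[R]_(m, n)) : R :=
  Num.sqrt (\sum_i \sum_j A i j ^+ 2).

Definition L2 (Omega : set (R * R * R)) (g : R * R * R -> R) :=
  measurable_fun (Omega : set (space3 R)) g /\
  leb3.-integrable Omega (fun x => (g x ^+ 2)%:E).

Definition is_H1_grad (Omega : set (R * R * R)) (u : R * R * R -> 'rV[R]_3)
    (G : R * R * R -> 'M[R]_3) :=
  [/\ forall j, L2 Omega (fun x => u x 0 j),
      forall j k, L2 Omega (fun x => G x j k)
    & forall phi, test_function Omega phi -> forall j k,
        \int[leb3]_(x in Omega) (u x 0 j * partial k phi x) =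
        - \int[leb3]_(x in Omega) (G x j k * phi x)].

Definition H1 (Omega : set (R * R * R)) (u : R * R * R -> 'rV[R]_3) :=
  exists G, is_H1_grad Omega u G.

(* Weak gradients are unique only up to a null set; this picks one, with
   [grad Omega u x j k] representing the k-th partial derivative of u_j. *)
Definition grad (Omega : set (R * R * R)) (u : R * R * R -> 'rV[R]_3) :
    R * R * R -> 'M[R]_3 :=
  xget (fun=> 0) [set G | is_H1_grad Omega u G].

Definition H1S2 (Omega : set (R * R * R)) (u : R * R * R -> 'rV[R]_3) :=
  H1 Omega u /\ {ae leb3, forall x, Omega x -> enorm (u x) = 1}.

Definition F_energy (Omega : set (R * R * R)) (f : R * R * R -> 'rV[R]_3)
    (N : nat) (lambda : R) (U : 'I_N -> R * R * R -> 'rV[R]_3) : \bar R :=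
  (\int[leb3]_(x in Omega)
     (2^-1 * \sum_(i < N) enorm (grad Omega (U i) x) ^+ 2 +
      lambda * enorm (\sum_(i < N) U i x - f x) ^+ 2)%:E)%E.

Definition E_energy (Omega : set (R * R * R)) (f : R * R * R -> 'rV[R]_3)
    (N : nat) (lambda : R) : \bar R :=
  ereal_inf [set F_energy Omega f lambda U |
    U in [set U : 'I_N -> R * R * R -> 'rV[R]_3 |
      forall i, H1S2 Omega (U i)]].

End Sobolev.

(* Main.v *)
Require Import Defs.
From HB Require Import structures.
From mathcomp Require Import all_boot all_order all_algebra.
From mathcomp Require Import all_classical all_reals all_analysis.
From mathcomp Require Import measurable_realfun ring.

Set Implicit Arguments.
Unset Strict Implicit.
Unset Printing Implicit Defensive.

Import Order.TTheory GRing.Theory Num.Theory.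
Import numFieldNormedType.Exports.

Local Open Scope classical_set_scope.
Local Open Scope ring_scope.

(** Take [u_1 = f], and let [u_2, ..., u_N] be constant unit vectors whose sum
    is zero. Such vectors exist because [N - 1 >= 2]: opposite pairs, together
    with one equilateral triangle when [N - 1] is odd ([unit_vectors_sum0]).
    The penalty term of the energy of this competitor vanishes, so its energy is
    the Dirichlet energy, which is finite and does not depend on [lambda]
    ([E_energy_le_of_sum]).

    The analytic content is that a constant belongs to [H1 Omega], with weak
    gradient zero ([is_H1_grad_cst]). Constants are square integrable because
    the bounded open set [Omega] has finite measure. It remains to see that a
    partial derivative of a test function [phi] has integral zero
    ([integral_partial_eq0]): it is integrable, being continuous with bounded
    support; by Fubini its integral can be computed by integrating first along
    the lines in the direction of the derivative; and on each such line the
    fundamental theorem of calculus gives zero, as [phi] vanishes at both ends.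

    Fubini's theorem needs open subsets of [R * R * R] to be measurable for the
    product sigma-algebra, which holds because they are countable unions of
    rational cubes ([open_measurable_space3]). *)

(** * Vanishing of iterated integrals *)

Lemma integral_prod_eq0l (d1 d2 : measure_display)
    (T1 : measurableType d1) (T2 : measurableType d2)
    (R : realType) (m1 : {sigma_finite_measure set T1 -> \bar R})
    (m2 : {sigma_finite_measure set T2 -> \bar R}) (F : T1 * T2 -> \bar R) :
  (m1 \x m2)%E.-integrable setT F ->
  (forall x, \int[m2]_y F (x, y) = 0)%E ->
  (\int[m1 \x m2]_z F z = 0)%E.
Proof.
move=> iF F0; rewrite -integral12_prod_meas1// integral0_eq// => x _.
exact: F0.
Qed.

(** Only the integrable slices have to be considered, since almost every slice is
    integrable; this makes the lemma usable for iterating Fubini. *)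
Lemma integral_prod_eq0r (d1 d2 : measure_display)
    (T1 : measurableType d1) (T2 : measurableType d2)
    (R : realType) (m1 : {sigma_finite_measure set T1 -> \bar R})
    (m2 : {sigma_finite_measure set T2 -> \bar R}) (F : T1 * T2 -> \bar R) :
  (m1 \x m2)%E.-integrable setT F ->
  (forall y, m1.-integrable setT (fun x => F (x, y)) ->
    \int[m1]_x F (x, y) = 0)%E ->
  (\int[m1 \x m2]_z F z = 0)%E.
Proof.
move=> iF F0; rewrite -integral21_prod_meas1//.
rewrite -[RHS](@integral0 _ _ R m2 setT).
apply: ae_eq_integral => [//|||].
- exact: (measurable_fubini_G iF).
- exact: measurable_cst.
- by have := ae_integrable2 iF; apply: filterS => y iFy _; exact: F0.
Qed.

Section Space3.
Context (R : realType).

(** * Measurability of open sets and continuous functions *)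

Lemma open_measurable_space3 (U : set (R * R * R)) :
  open U -> measurable (U : set (space3 R)).
Proof.
move=> oU.
pose B (i : rat * rat * rat * nat) : set (space3 R) :=
  ball (ratr i.1.1.1 : R) i.2.+1%:R^-1 `*` ball (ratr i.1.1.2 : R) i.2.+1%:R^-1
  `*` ball (ratr i.1.2 : R) i.2.+1%:R^-1.
(* [B i] is the open cube with rational center and radius [i.2.+1%:R^-1]. *)
have mB i : measurable (B i).
  by apply: measurableX; [apply: measurableX|];
     exact: open_measurable (ball_open _ _).
have -> : U = \bigcup_i (if `[< B i `<=` U >] then B i else set0).
  apply/seteqP; split => [x Ux|x [i _]]; last first.
    by case: ifP => [/asboolP|] // + Bx; exact.
  have [e /= e0 eU] : exists2 e : R, 0 < e & ball x e `<=` U.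
    by move/nbhs_ballP : (open_nbhs_nbhs (conj oU Ux)).
  have e20 : 0 < e / 2 by rewrite divr_gt0.
  have [n /= _ /(_ n (leqnn n)) /= ne] := near_infty_natSinv_lt (PosNum e20).
  have n0 : 0 < n.+1%:R^-1 :> R by rewrite invr_gt0.
  have approx (t : R) : exists q : rat, ball t n.+1%:R^-1 (ratr q).
    have [|q] := @rat_in_itvoo R (t - n.+1%:R^-1) (t + n.+1%:R^-1).
      by rewrite ltrBlDr -addrA ltrDl addr_gt0.
    by rewrite in_itv /= => qt; exists q; rewrite /ball /= ltr_distlC.
  move: x Ux eU => [[x1 x2] x3] Ux eU.
  have [[q1 h1] [q2 h2]] := (approx x1, approx x2).
  have [q3 h3] := approx x3.
  have BU : B (q1, q2, q3, n) `<=` U.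
    move=> -[[y1 y2] y3] [[/= b1 b2] b3]; apply: eU.
    have tri (s t : R) q : ball s n.+1%:R^-1 (ratr q) ->
        ball (ratr q : R) n.+1%:R^-1 t -> ball s e t.
      move=> sq qt; rewrite [e]splitr.
      by apply: ball_triangle (le_ball (ltW ne) sq) (le_ball (ltW ne) qt).
    by split; [split|]; [exact: tri h1 b1|exact: tri h2 b2|exact: tri h3 b3].
  exists (q1, q2, q3, n) => //.
  have -> : `[< B (q1, q2, q3, n) `<=` U >] by apply/asboolP.
  by split; [split|] => /=; exact: ball_sym.
apply: countable_bigcupT_measurable => //.
by move=> i; case: ifP.
Qed.

Lemma continuous_measurable_space3 (g : R * R * R -> R) (D : set (R * R * R)) :
  measurable (D : set (space3 R)) ->
  continuous g -> measurable_fun (D : set (space3 R)) g.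
Proof.
move=> mD cg; apply: (@measurable_funTS _ _ (space3 R) R D g).
apply: (measurability _ (RGenOpens.measurableE R)).
move=> _ [_ [a [b ->] <-]]; rewrite setTI.
apply: open_measurable_space3; move/continuousP: cg; apply.
exact: interval_open.
Qed.

(** * Boxes centered at the origin *)

(** The interval [[-M, M]], on the copy of [R] that carries the Borel sets. *)
Definition sym_itv (M : R) : set (measurableTypeR R) := `[- M, M]%classic.

Lemma mem_sym_itv (M t : R) : sym_itv M t = (`|t| <= M) :> Prop.
Proof. by rewrite /sym_itv /= in_itv /= ler_norml. Qed.

Lemma measurable_sym_itv M : measurable (sym_itv M).
Proof. exact: measurable_itv. Qed.

Lemma lebesgue_sym_itv M : (lebesgue_measure (sym_itv M) < +oo)%E.
Proof.
by rewrite lebesgue_measure_itv /=; case: ifP; rewrite ?ltry// -EFinB ltry.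
Qed.

Lemma leb2_sym_itv M : (leb2 (sym_itv M `*` sym_itv M) < +oo)%E.
Proof.
have mI := measurable_sym_itv M; have fI := lebesgue_sym_itv M.
suff -> : leb2 (sym_itv M `*` sym_itv M) =
    (lebesgue_measure (sym_itv M) * lebesgue_measure (sym_itv M))%E.
  by rewrite lte_mul_pinfty// ge0_fin_numE.
exact: (product_measure1E (@lebesgue_measure R) (@lebesgue_measure R)).
Qed.

Lemma leb2_sigma_finite : sigma_finite setT (@leb2 R).
Proof.
exists (fun n => sym_itv n%:R `*` sym_itv n%:R).
  apply/esym/seteqP; split => // -[x y] _.
  exists (Num.bound (Num.max `|x| `|y|)) => //.
  have := @archi_boundP R (Num.max `|x| `|y|).
  rewrite le_max normr_ge0 => /(_ isT) /ltW; rewrite ge_max => /andP[hx hy].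
  by split; rewrite /= mem_sym_itv.
move=> n; split; last exact: leb2_sym_itv.
by apply: measurableX; exact: measurable_sym_itv.
Qed.

(** Makes Fubini's theorem available for [leb3], seen as the product of [leb2] and
    the Lebesgue measure on the line. *)
HB.instance Definition _ := Measure_isSigmaFinite.Build _ _ _ (@leb2 R)
  leb2_sigma_finite.

(** The cube of half-side [M] centered at the origin. *)
Definition box3 (M : R) : set (space3 R) :=
  sym_itv M `*` sym_itv M `*` sym_itv M.

Lemma measurable_box3 M : measurable (box3 M).
Proof.
by apply: measurableX; [apply: measurableX|]; exact: measurable_sym_itv.
Qed.

Lemma leb3_box3 M : (leb3 (box3 M) < +oo)%E.
Proof.
have mI := measurable_sym_itv M; have fI := lebesgue_sym_itv M.
suff -> : leb3 (box3 M) = (leb2 (sym_itv M `*` sym_itv M) *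
    lebesgue_measure (sym_itv M))%E.
  have f2 := leb2_sym_itv M; by rewrite lte_mul_pinfty// ge0_fin_numE.
apply: (product_measure1E (@leb2 R) (@lebesgue_measure R)) => //.
exact: measurableX.
Qed.

Lemma bounded_box3 (A : set (R * R * R)) :
  bounded_set A -> exists M : R, A `<=` box3 M.
Proof.
move=> [m [_ mA]]; exists (`|m| + 1).
move=> [[a b] c] /mA; have mm : m < `|m| + 1.
  by rewrite (le_lt_trans (ler_norm _))// ltrDl.
(* The norm on a product is the maximum of the norms of the components. *)
move=> /(_ _ mm) /=; rewrite -[`|_|]/(Num.max (Num.max `|a| `|b|) `|c|).
rewrite !ge_max => /andP[/andP[ha hb] hc].
by split; [split|]; rewrite /= mem_sym_itv.
Qed.

(** * The integral of a partial derivative of a test function *)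

Lemma integral_derive1_eq0 (g : R -> R) (M : R) :
  (forall t, derivable g t 1) -> continuous (derive1 g) ->
  (forall t, M < `|t| -> g t = 0) ->
  (\int[lebesgue_measure]_t (derive1 g t)%:E = 0)%E.
Proof.
move=> dg cg' g0.
(* The support of [g] lies in [[-M, M]], hence strictly inside [[-b, b]]. *)
pose b : R := `|M| + 1.
have b0 : 0 < b by rewrite ltr_wpDl.
have Mb : M < b by rewrite (le_lt_trans (ler_norm _))// ltrDl.
have cg : continuous g.
  by move=> t; apply/differentiable_continuous/derivable1_diffP.
have -> : (\int[lebesgue_measure]_t (derive1 g t)%:E =
    \int[lebesgue_measure]_(t in `[(- b)%R, b]) (derive1 g t)%:E)%E.
  rewrite [RHS]integral_mkcond; apply: eq_integral => t _.
  rewrite patchE; case: ifPn => // /negP tb; congr EFin.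
  have bt : M < `|t|.
    rewrite ltNge; apply/negP => tM; apply: tb; rewrite inE /= in_itv /=.
    by rewrite -ler_norml (le_trans tM)// ltW.
  rewrite derive1E (near_eq_derive (g := cst 0)) ?derive_cst//.
  have : \forall s \near t, M < `|s|.
    exact: cvgr_gt (@norm_continuous _ R t) M bt.
  by apply: filterS => s; exact: g0.
transitivity ((g b)%:E - (g (- b)%R)%:E)%E; last first.
  by rewrite !g0 ?sube0// ?normrN gtr0_norm.
apply: continuous_FTC2; last by [].
- by rewrite gtrN.
- exact: continuous_subspaceT.
- split=> [t _||]; first exact: dg.
    by apply: cvg_at_right_filter; exact: cg.
  by apply: cvg_at_left_filter; exact: cg.
Qed.

Lemma partial_eq0 (phi : R * R * R -> R) k (x : R * R * R) :
  ~ closure [set y | phi y != 0] x -> partial k phi x = 0.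
Proof.
move=> xS; rewrite /partial (near_eq_derive (g := cst 0)) ?derive_cst//.
have oS : open (~` closure [set y | phi y != 0]).
  by apply: closed_openC; exact: closed_closure.
have := open_nbhs_nbhs (conj oS (xS : (~` _) x)).
apply: filterS => y yS /=; apply/eqP/negPn/negP => py.
by apply: yS; exact: subset_closure.
Qed.

Section TestFunction.
Context (Omega : set (R * R * R)) (phi : R * R * R -> R).
Context (tphi : test_function Omega phi).

Lemma continuous_partial k : continuous (partial k phi).
Proof. by have [/(_ [:: k])[+ _] _ _] := tphi. Qed.

Lemma test_function_box3 : exists M : R, forall x,
  ~ box3 M x -> phi x = 0 /\ forall k, partial k phi x = 0.
Proof.
have [_ /compact_bounded/bounded_box3[M SM] _] := tphi.
exists M => // x xM; have xS : ~ closure [set y | phi y != 0] x by move/SM.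
split; last by move=> k; exact: partial_eq0.
by apply/eqP/negPn/negP => px; apply: xS; exact: subset_closure.
Qed.

Lemma integrable_partial k :
  (leb3 (R := R)).-integrable setT (EFin \o partial k phi).
Proof.
have [M pM] := test_function_box3.
have -> : EFin \o partial k phi = (EFin \o partial k phi) \_ (box3 M).
  apply/funext => x; rewrite patchE; case: ifPn => // /negP xM /=.
  by rewrite (pM x _).2// => Mx; apply: xM; rewrite inE.
apply: (integrable_mkcond (mu := leb3 (R := R)) _ (measurable_box3 M)).1.
apply: measurable_bounded_integrable.
- exact: measurable_box3.
- exact: leb3_box3.
- apply: continuous_measurable_space3; first exact: measurable_box3.
  exact: continuous_partial.
- have [_ cS _] := tphi.
  have cp : {within closure [set x | phi x != 0], continuous (partial k phi)}.
    exact/continuous_subspaceT/continuous_partial.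
  have /compact_bounded[m [_ mP]] := continuous_compact cp cS.
  exists (Num.max m 0); split; first exact: num_real.
  move=> t; rewrite gt_max => /andP[mt t0] x _ /=.
  have [xS|xS] := pselect (closure [set y | phi y != 0] x).
    by apply: (mP _ mt); exists x.
  by rewrite partial_eq0// normr0 ltW.
Qed.

(** The hypothesis on [s] says that [s] parametrizes, at unit speed, a line in the
    direction of the [k]-th basis vector. *)
Lemma partial_line k (s : R -> R * R * R) (t : R) :
  (forall h t, s (h + t) = h *: basis3 k + s t) ->
  derivable (phi \o s) t 1 /\ 'D_1 (phi \o s) t = partial k phi (s t).
Proof.
move=> sD.
have E : (fun h : R => h^-1 *: ((phi \o s) (h *: 1 + t) - (phi \o s) t)) =
    (fun h : R => h^-1 *: (phi (h *: basis3 k + s t) - phi (s t))).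
  by apply/funext => h /=; rewrite -sD -[h *: 1]/(h * 1) mulr1.
have [/(_ [::])[_ /(_ k (s t)) /= dphi] _ _] := tphi.
by rewrite /derivable /partial /derive E.
Qed.

(** The second hypothesis on [s] says that the parameter is bounded by the
    coordinates; it ensures that [phi \o s] has bounded support. *)
Lemma integral_line_eq0 k (s : R -> R * R * R) :
  (forall h t, s (h + t) = h *: basis3 k + s t) ->
  (forall M t, box3 M (s t) -> `|t| <= M) ->
  (\int[lebesgue_measure]_t (partial k phi (s t))%:E = 0)%E.
Proof.
move=> sD sM; have [M pM] := test_function_box3.
have dE : derive1 (phi \o s) = partial k phi \o s.
  by apply/funext => t; rewrite derive1E (partial_line t sD).2.
transitivity (\int[lebesgue_measure]_t (derive1 (phi \o s) t)%:E)%E.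
  by rewrite dE.
apply: (@integral_derive1_eq0 _ M).
- by move=> t; exact: (partial_line t sD).1.
- rewrite dE => t; apply: continuous_comp; last exact: continuous_partial.
  have -> : s = (fun h : R => h *: basis3 k + s 0).
    by apply/funext => h; rewrite -sD addr0.
  apply: cvgD; last exact: cvg_cst.
  exact: (@cvgZr_tmp _ _ _ _ _ id).
- by move=> t Mt /=; apply: (pM _ _).1 => /sM; rewrite leNgt Mt.
Qed.

Lemma integral_partial_eq0 (k : 'I_3) :
  (\int[leb3]_x (partial k phi x)%:E = 0)%E.
Proof.
have intp := integrable_partial k.
have bE (h a b c : R) : h *: (basis3 k : R * R * R) + (a, b, c) =
    (h * (k == 0 :> nat)%:R + a, h * (k == 1 :> nat)%:R + b,
     h * (k == 2 :> nat)%:R + c) by [].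
have [k2|k2] := eqVneq (k : nat) 2%N.
  apply: (@integral_prod_eq0l _ _ _ _ _
    (@leb2 R) (@lebesgue_measure R) _ intp) => -[a b].
  apply: (integral_line_eq0 (k := k) (s := fun t => (a, b, t))).
    by move=> h t; rewrite bE k2 /= !mulr0 !add0r mulr1.
  by move=> M t [_ /=]; rewrite mem_sym_itv.
apply: (@integral_prod_eq0r _ _ _ _ _
    (@leb2 R) (@lebesgue_measure R) _ intp) => c intc.
have [k1|k1] := eqVneq (k : nat) 1%N.
  apply: (@integral_prod_eq0l _ _ _ _ _
    (@lebesgue_measure R) (@lebesgue_measure R) _ intc) => a.
  apply: (integral_line_eq0 (k := k) (s := fun t => (a, t, c))).
    by move=> h t; rewrite bE k1 /= !mulr0 !add0r mulr1.
  by move=> M t [[_ /=]]; rewrite mem_sym_itv.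
have k0 : (k : nat) = 0%N by case: k k1 k2 {intp bE intc} => -[|[|[|]]].
apply: (@integral_prod_eq0r _ _ _ _ _
    (@lebesgue_measure R) (@lebesgue_measure R) _ intc) => b _.
apply: (integral_line_eq0 (k := k) (s := fun t => (t, b, c))).
  by move=> h t; rewrite bE k0 /= !mulr0 !add0r mulr1.
by move=> M t [[/= + _] _]; rewrite mem_sym_itv.
Qed.

Lemma integral_cst_partial_eq0 (c : R) (k : 'I_3) : open Omega ->
  (\int[leb3]_(x in Omega) (c * partial k phi x)%:E = 0)%E.
Proof.
move=> oO; have [_ _ SO] := tphi.
have mO := open_measurable_space3 oO.
have ip : (leb3 (R := R)).-integrable Omega (EFin \o partial k phi).
  exact: integrableS (integrable_partial k).
transitivity (c%:E * \int[leb3]_(x in Omega) (partial k phi x)%:E)%E.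
  by rewrite -(integralZl mO ip).
rewrite integral_mkcond -[RHS](mule0 c%:E) -(integral_partial_eq0 k).
congr (_ * _)%E; apply: eq_integral => x _; rewrite patchE.
case: ifPn => // /negP xO; rewrite partial_eq0// => /SO Ox.
by apply: xO; rewrite inE.
Qed.
End TestFunction.

(** * Constants in [H1 Omega] *)

Lemma leb3_bounded_open (Omega : set (R * R * R)) :
  open Omega -> bounded_set Omega -> (leb3 (Omega : set (space3 R)) < +oo)%E.
Proof.
move=> /open_measurable_space3 mO /bounded_box3[M OM].
apply: le_lt_trans (leb3_box3 M).
by apply: le_measure => //; rewrite inE//; exact: measurable_box3.
Qed.

Lemma L2_cst (Omega : set (R * R * R)) (c : R) :
  open Omega -> bounded_set Omega -> L2 Omega (fun=> c).
Proof.
move=> oO bO; split; first exact: measurable_cst.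
apply: (@measurable_bounded_integrable _ _ _ leb3 (fun=> c ^+ 2)).
- exact: open_measurable_space3.
- exact: leb3_bounded_open.
- exact: measurable_cst.
- exact: bounded_cst.
Qed.

Lemma is_H1_grad_cst (Omega : set (R * R * R)) (v : 'rV[R]_3) :
  open Omega -> bounded_set Omega -> is_H1_grad Omega (fun=> v) (fun=> 0).
Proof.
move=> oO bO; split=> [j|j k|phi tphi j k].
- exact: L2_cst.
- exact: L2_cst.
- rewrite /Rintegral (integral_cst_partial_eq0 tphi)// integral0_eq ?oppr0//.
  by move=> x _; rewrite mxE mul0r.
Qed.

Lemma H1S2_cst (Omega : set (R * R * R)) (v : 'rV[R]_3) :
  open Omega -> bounded_set Omega -> enorm v = 1 -> H1S2 Omega (fun=> v).
Proof.
move=> oO bO v1; split; first by exists (fun=> 0); exact: is_H1_grad_cst.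
exact: aeW.
Qed.

(** * Unit vectors with zero sum *)

(** The vector [(x, y, 0)]. *)
Definition plane_vec (x y : R) : 'rV[R]_3 := \row_j [:: x; y; 0]`_j.

Lemma enorm_plane_vec x y : enorm (plane_vec x y) = Num.sqrt (x ^+ 2 + y ^+ 2).
Proof.
by rewrite /enorm big_ord1 !big_ord_recr big_ord0 /= !mxE /= add0r expr0n addr0.
Qed.

Lemma unit_vectors_sum0 n : exists s : seq 'rV[R]_3,
  [/\ size s = n.+2, forall v, v \in s -> enorm v = 1 & \sum_(v <- s) v = 0].
Proof.
have e1 : enorm (plane_vec 1 0) = 1.
  by rewrite enorm_plane_vec expr1n expr0n addr0 sqrtr1.
have e2 : enorm (plane_vec (- 1) 0) = 1.
  by rewrite enorm_plane_vec sqrrN expr1n expr0n addr0 sqrtr1.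
have eT (a : R) : a ^+ 2 = 3 / 4 -> enorm (plane_vec (- 2^-1) a) = 1.
  move=> a2; rewrite enorm_plane_vec a2 sqrrN exprVn.
  by rewrite (_ : _ + _ = 1) ?sqrtr1//; field.
have s34 : Num.sqrt (3 / 4 : R) ^+ 2 = 3 / 4 by rewrite sqr_sqrtr.
elim/ltn_ind: n => -[|[|n]] IH.
- exists [:: plane_vec 1 0; plane_vec (- 1) 0]; split => //.
    by move=> v; rewrite !inE => /orP[] /eqP ->.
  rewrite !big_cons big_nil; apply/rowP => j; rewrite !mxE.
  by case: j => -[|[|[|]]] //= _; rewrite addr0 ?subrr ?addr0.
(* An equilateral triangle. *)
- pose a : R := Num.sqrt (3 / 4).
  exists [:: plane_vec 1 0; plane_vec (- 2^-1) a; plane_vec (- 2^-1) (- a)].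
  split => //.
    move=> v; rewrite !inE => /or3P[] /eqP -> //; apply: eT => //.
    by rewrite sqrrN.
  rewrite !big_cons big_nil; apply/rowP => j; rewrite !mxE.
  by case: j => -[|[|[|]]] //= _; field.
(* Adding an opposite pair. *)
- have [s [sz s1 s0]] := IH n (ltnW (ltnSn _)).
  exists [:: plane_vec 1 0, plane_vec (- 1) 0 & s]; split; first by rewrite /= sz.
    by move=> v; rewrite !inE => /or3P[/eqP ->|/eqP ->|/s1].
  rewrite !big_cons s0 addr0; apply/rowP => j; rewrite !mxE.
  by case: j => -[|[|[|]]] //= _; rewrite ?subrr ?addr0.
Qed.

(** * The energy *)

Lemma enorm_sqr m n (A : 'M[R]_(m, n)) :
  enorm A ^+ 2 = \sum_i \sum_j A i j ^+ 2.
Proof.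
rewrite /enorm sqr_sqrtr// !sumr_ge0// => i _; rewrite sumr_ge0// => j _.
exact: sqr_ge0.
Qed.

Lemma is_H1_grad_grad (Omega : set (R * R * R)) (u : R * R * R -> 'rV[R]_3) :
  H1 Omega u -> is_H1_grad Omega u (grad Omega u).
Proof.
by move=> Hu; exact: (@xgetPex _ (fun=> 0) [set G | is_H1_grad Omega u G]).
Qed.

Lemma integrable_grad_energy (Omega : set (R * R * R)) (N : nat)
    (U : 'I_N -> R * R * R -> 'rV[R]_3) :
  open Omega -> (forall i, H1 Omega (U i)) ->
  (leb3 (R := R)).-integrable Omega
    (fun x => (2^-1 * \sum_(i < N) enorm (grad Omega (U i) x) ^+ 2)%:E).
Proof.
move=> oO HU; have mO := open_measurable_space3 oO.
have -> : (fun x => (2^-1 * \sum_(i < N) enorm (grad Omega (U i) x) ^+ 2)%:E) =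
    (fun x => (2^-1)%:E * \sum_(i < N) \sum_(j < 3) \sum_(k < 3)
      (grad Omega (U i) x j k ^+ 2)%:E)%E.
  apply/funext => x; rewrite EFinM -sumEFin; congr (_ * _)%E.
  apply: eq_bigr => i _; rewrite enorm_sqr -sumEFin.
  by apply: eq_bigr => j _; rewrite -sumEFin.
apply: integrableZl => //.
apply: integrable_sum => // i _; apply: integrable_sum => // j _.
apply: integrable_sum => // k _.
by have [_ /(_ j k)[]] := is_H1_grad_grad (HU i).
Qed.

Lemma E_energy_le_of_sum (Omega : set (R * R * R)) (N : nat)
    (f : R * R * R -> 'rV[R]_3) (U : 'I_N -> R * R * R -> 'rV[R]_3) :
  open Omega -> (forall i, H1S2 Omega (U i)) ->
  (forall x, \sum_(i < N) U i x = f x) ->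
  exists C : R, 0 < C /\
    forall lambda : R, 0 < lambda -> (E_energy Omega f N lambda <= C%:E)%E.
Proof.
move=> oO HU Uf; have mO := open_measurable_space3 oO.
have iU := integrable_grad_energy oO (fun i => (HU i).1).
pose I := (\int[leb3]_(x in Omega)
    (2^-1 * \sum_(i < N) enorm (grad Omega (U i) x) ^+ 2)%:E)%E.
have If : I \is a fin_num := integrable_fin_num mO iU.
exists (`|fine I| + 1); split; first by rewrite ltr_wpDl.
move=> lambda _; apply: (@le_trans _ _ (F_energy Omega f lambda U)).
  by apply: ereal_inf_lbound; exists U.
have -> : F_energy Omega f lambda U = I.
  apply: eq_integral => x _; rewrite Uf subrr enorm_sqr.
  rewrite [X in lambda * X]big1 ?mulr0 ?addr0// => i _.
  by rewrite big1// => j _; rewrite mxE expr0n.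
by rewrite -(fineK If) lee_fin (le_trans (ler_norm _))// lerDl.
Qed.

End Space3.

Theorem proposition4p1 (R : realType) (Omega : set (R * R * R)) (N : nat)
    (f : R * R * R -> 'rV[R]_3) :
  bounded_domain Omega -> (3 <= N)%N -> H1S2 Omega f ->
  (exists U : 'I_N -> R * R * R -> 'rV[R]_3,
     (forall i, H1S2 Omega (U i)) /\
     {ae leb3, forall x, Omega x -> \sum_(i < N) U i x = f x}) /\
  (exists C : R, 0 < C /\
     forall lambda : R, 0 < lambda -> (E_energy Omega f N lambda <= C%:E)%E).
Proof.
move=> [oO _ _ bO] N3 Hf.
case: N N3 => [|[|[|n]]]// _.
have [s [sz s1 s0]] := unit_vectors_sum0 R n.
pose U (i : 'I_n.+3) : R * R * R -> 'rV[R]_3 :=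
  if i is Ordinal i'.+1 _ then fun=> s`_i' else f.
have HU i : H1S2 Omega (U i).
  case: i => -[//|i] /= i_lt; apply: H1S2_cst => //.
  by apply/s1/mem_nth; rewrite sz.
have Uf x : \sum_(i < n.+3) U i x = f x.
  rewrite big_ord_recl /= -[RHS]addr0; congr (_ + _).
  by rewrite -[RHS]s0 [RHS](big_nth 0) sz big_mkord.
split; last exact: E_energy_le_of_sum HU Uf.
by exists U; split => //; apply: aeW.
Qed.
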